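(* Let $P_1$ and $P_2$ be two (Borel) probability measures on a separable Hilbert space $\mathbb{H}$ over the field $\mathbb{R}$. Let $\psi:\mathbb{R}^{+}\to[0,1]$ be a bounded continuous, strictly decreasing and positive definite function (e.g. $\psi(t)=e^{-t^2}$), such that $k(x,y)=\psi(\|x-y\|_{\mathbb{H}})$ is a translation-invariant characteristic kernel on $\mathbb{H}$. Let $m_{P_1}$ and $m_{P_2}$ be the kernel mean embeddings of $P_1$ and $P_2$, respectively, for the kernel $k$. If $m_{P_2}(y)>m_{P_1}(y)$ for a given $y\in\mathbb{H}$, then there exists an open ball $B_r(y)$ (with $r>0$) such that $P_2(B_r(y))>P_1(B_r(y))$, and $r$ depends only on the difference $m_{P_2}(y)-m_{P_1}(y)$ and the characteristic kernel $k$ itself.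
   Context: $\mathbb{R}^+=[0,\infty)$ and $B_r(y)=\{x\in\mathbb{H}:\|x-y\|_{\mathbb{H}}<r\}$. A function $k:\mathbb{H}\times\mathbb{H}\to\mathbb{R}$ is a positive definite kernel if it is symmetric and $\sum_{i,j=1}^n a_ia_jk(x_i,x_j)\ge 0$ for all $n\in\mathbb{N}$, $a_i\in\mathbb{R}$, $x_i\in\mathbb{H}$; it is strictly positive definite if equality (for distinct $x_i$) implies $a_1=\dots=a_n=0$. It is translation-invariant if $k(x,y)$ is a function of $x-y$ only. That $\psi$ is positive definite means that $(x,y)\mapsto\psi(\|x-y\|_{\mathbb{H}})$ is a positive definite kernel. $\mathcal{H}_k$ denotes the reproducing kernel Hilbert space of $k$. The kernel mean embedding (kernel mean function) of a probability measure $P$ is $m_P(\cdot)=\int_{\mathbb{H}}k(x,\cdot)\,P(dx)\in\mathcal{H}_k$. A strictly positive definite kernel $k$ is characteristic for a family of measures $\mathscr{P}$ if the map $\mathscr{P}\to\mathcal{H}_k$, $P\mapsto m_P$, is injective; ''characteristic'' without further qualification refers to the family of all Borel probability measures on $\mathbb{H}$.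
   Formalization: Since no single r can depend only on the number m_{P2}(y)-m_{P1}(y) and k (Dirac measures refute it), r here depends on k, y and the whole function m_{P2}-m_{P1}, and lies in a finite list determined by that number and k. *)

(* Defs.v *)
From HB Require Import structures.
From mathcomp Require Import all_boot all_order all_algebra.
From mathcomp Require Import all_classical all_reals all_analysis.
Import Order.TTheory GRing.Theory Num.Theory.
Import numFieldNormedType.Exports.

Set Implicit Arguments.
Unset Strict Implicit.
Unset Printing Implicit Defensive.

Local Open Scope classical_set_scope.
Local Open Scope ring_scope.

Definition separable_space (T : topologicalType) : Prop :=
  exists2 D : set T, countable D & dense D.

(* [completeNormedModType] provides the norm and its completeness; a Hilbert
   space is one whose norm comes from a symmetric positive definite bilinear
   form ([{dot H for idfun}] is the library type of such forms over reals). *)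
Definition inner_product_of_norm (R : realType) (H : completeNormedModType R)
    (dot : {dot H for idfun}) : Prop :=
  forall x : H, `|x| ^+ 2 = dot x x.

Definition Borel (T : ptopologicalType) := g_sigma_algebraType (@open T).

Section Kernels.
Context {R : realType} {T : Type}.
Implicit Types k : T -> T -> R.

Definition positive_definite_kernel k : Prop :=
  (forall x y, k x y = k y x) /\
  (forall (n : nat) (a : 'I_n -> R) (x : 'I_n -> T),
     0 <= \sum_(i < n) \sum_(j < n) a i * a j * k (x i) (x j)).

Definition strictly_positive_definite_kernel k : Prop :=
  positive_definite_kernel k /\
  (forall (n : nat) (a : 'I_n -> R) (x : 'I_n -> T), injective x ->
     \sum_(i < n) \sum_(j < n) a i * a j * k (x i) (x j) = 0 ->
     forall i, a i = 0).

End Kernels.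

Definition translation_invariant (R : realType) (H : zmodType)
    (k : H -> H -> R) : Prop :=
  exists f : H -> R, forall x y, k x y = f (x - y).

Section MeanEmbedding.
Context {R : realType} {T : ptopologicalType}.
Implicit Types (k : T -> T -> R) (P Q : probability (Borel T) R).

(* As the elements of the reproducing kernel Hilbert space of [k] are functions
   on [T], the embedding is represented by the function itself. *)
Definition mean_embedding k P : T -> R := fun y => \int[P]_x k x y.

(* Equality of measures is tested on Borel sets only: a term of type
   [probability _ R] also assigns (unconstrained) values to the other sets, so
   Leibniz equality [P = Q] would be too strong. *)
Definition characteristic_for k (F : set (probability (Borel T) R)) : Prop :=
  strictly_positive_definite_kernel k /\
  (forall P Q, F P -> F Q -> mean_embedding k P = mean_embedding k Q ->
     forall A : set (Borel T), measurable A -> P A = Q A).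

Definition characteristic k : Prop := characteristic_for k setT.

End MeanEmbedding.

Definition radial_kernel (R : realType) (H : normedModType R) (psi : R -> R) :
    H -> H -> R :=
  fun x y => psi `|x - y|.
Arguments radial_kernel {R} H psi.

(* Main.v *)
(* Fix [delta > 0] and choose [N] with [1 / N < delta].  If every superlevel set
   [{x | psi |x - y| > j / N}], [j < N], had at least as much mass under [P1] as
   under [P2], a layer-cake approximation of [psi] would give
   [m2 y <= m1 y + 1 / N], against [m2 y - m1 y = delta].  As [psi] is continuous
   and strictly decreasing, a superlevel set is empty, the whole space or a ball
   whose radius depends on [psi] and [j / N] only; the first two have equal mass
   under all probability measures, so some ball gains mass.  Which of these
   finitely many radii works is decided by the function [m2 - m1] alone: the
   kernel being characteristic, that function determines [P2 - P1]. *)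
Require Import Defs.
From HB Require Import structures.
From mathcomp Require Import all_boot all_order all_algebra.
From mathcomp Require Import all_classical all_reals all_analysis.
From mathcomp Require Import measurable_realfun.
From mathcomp Require Import lra.
Import Order.TTheory GRing.Theory Num.Theory.
Import numFieldNormedType.Exports.

Set Implicit Arguments.
Unset Strict Implicit.
Unset Printing Implicit Defensive.

Local Open Scope classical_set_scope.
Local Open Scope ring_scope.

(** The sum counts the naturals below [x], so it is the ceiling of [x]; [x <= n] ensures that none
    is cut off. *)
Lemma sum_indicator_lt_bounds (R : realDomainType) (n : nat) (x : R) :
  0 <= x <= n%:R ->
  x <= \sum_(j < n) (j%:R < x)%R%:R <= x + 1.
Proof.
elim: n => [|n IH] /andP[x0 xn].
  by rewrite big_ord0; apply/andP; split => //; rewrite addr_ge0.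
have [xn'|nx] := leP x n%:R.
  rewrite big_ord_recr /= (ltNge n%:R) xn' addr0.
  by apply: IH; rewrite x0 xn'.
have -> : \sum_(j < n.+1) (j%:R < x)%R%:R = n.+1%:R :> R.
  transitivity (\sum_(j < n.+1) 1 : R); last first.
    by rewrite sumr_const card_ord.
  apply: eq_bigr => j _.
  by rewrite (le_lt_trans _ nx)// ler_nat -ltnS.
by rewrite xn -natr1 lerD2r ltW.
Qed.

(** * Comparison of integrals through superlevel sets *)

Section layer_cake.
Context d (T : measurableType d) (R : realType).

Lemma integrable_bounded01 (P : probability T R) (f : T -> R) :
  measurable_fun setT f -> (forall x, 0 <= f x <= 1) ->
  P.-integrable setT (EFin \o f).
Proof.
move=> mf f01; apply: measurable_bounded_integrable => //.
  by apply: le_lt_trans (probability_le1 P measurableT) _; rewrite ltry.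
exists 1; split; rewrite ?num_real// => M M1 x _ /=.
have /andP[f0 f1] := f01 x.
by rewrite ger0_norm// (le_trans f1)// ltW.
Qed.

(* The step function [N^-1 * #{j < N | j / N < f}] exceeds [f] by at most
   [N^-1], and its integral only involves the measures of superlevel sets. *)
Lemma Rintegral_le_superlevel (P1 P2 : probability T R) (f : T -> R) (N : nat) :
  (0 < N)%N -> measurable_fun setT f -> (forall x, 0 <= f x <= 1) ->
  (forall j, (j < N)%N ->
     (P2 [set x | (j%:R / N%:R < f x)%R] <= P1 [set x | (j%:R / N%:R < f x)%R])%E) ->
  \int[P2]_x f x <= \int[P1]_x f x + N%:R^-1.
Proof.
move=> N0 mf f01 le21.
have NR0 : 0 < N%:R :> R by rewrite ltr0n.
pose A j := [set x | j%:R / N%:R < f x].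
have mA j : measurable (A j).
  rewrite (_ : A j = f @^-1` `]j%:R / N%:R, +oo[); last first.
    by apply/seteqP; split => x /=; rewrite in_itv/= andbT.
  by rewrite -[_ @^-1` _]setTI; exact: mf.
pose s (x : T) : R := \sum_(j < N) N%:R^-1 * \1_(A j) x.
have sE x : s x = N%:R^-1 * \sum_(j < N) (j%:R < N%:R * f x)%R%:R.
  rewrite /s mulr_sumr; apply: eq_bigr => j _; congr (_ * _).
  rewrite indicE; congr (nat_of_bool _)%:R.
  by apply/idP/idP; rewrite inE /A/= ltr_pdivrMr// mulrC.
have s_bounds x : f x <= s x <= f x + N%:R^-1.
  have /andP[f0 f1] := f01 x.
  have := @sum_indicator_lt_bounds _ N (N%:R * f x).
  rewrite mulr_ge0 ?ler0n//= ler_piMr ?ler0n// => /(_ isT) /andP[lo hi].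
  rewrite sE; apply/andP; split.
    by rewrite mulrC ler_pdivlMr// mulrC.
  rewrite mulrC ler_pdivrMr// mulrDl mulVf ?gt_eqF//.
  by rewrite [f x * _]mulrC.
have ms : measurable_fun setT s.
  apply: measurable_sum => j; exact: measurable_funM.
have intsE (P : probability T R) :
    (\int[P]_x (s x)%:E = \sum_(j < N) (N%:R^-1)%:E * P (A j))%E.
  under eq_integral do rewrite /s -sumEFin.
  rewrite ge0_integral_sum//; last first.
    by move=> j; apply/measurable_EFinP; exact: measurable_funM.
  apply: eq_bigr => j _.
  rewrite (integralZl_indic _ (fun=> A j))//; last by rewrite ltNge invr_ge0 ltW.
  by rewrite integral_indic// setIT.
have f_int P := integrable_bounded01 P mf f01.
rewrite -lee_fin EFinD /Rintegral !fineK; try exact/integrable_fin_num/f_int.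
(* Use [f <= s] under [P2], pass from [P2] to [P1] level by level, then use [s <= f + N^-1] under
   [P1], whose total mass is 1. *)
apply: (@le_trans _ _ (\int[P2]_x (s x)%:E)%E).
  apply: ge0_le_integral => //=.
  - by move=> x _; rewrite lee_fin; have /andP[] := f01 x.
  - exact/measurable_EFinP.
  - exact/measurable_EFinP.
  - by move=> x _; rewrite lee_fin; have /andP[] := s_bounds x.
apply: (@le_trans _ _ (\int[P1]_x (s x)%:E)%E).
  rewrite !intsE; apply: lee_sum => j _.
  by apply: lee_wpmul2l; [rewrite lee_fin invr_ge0 ltW|exact: le21].
have <- : (\int[P1]_x (f x + N%:R^-1)%:E =
           \int[P1]_x (f x)%:E + (N%:R^-1)%:E)%E.
  under eq_integral do rewrite EFinD.
  rewrite integralD//; [|exact: f_int|exact: finite_measure_integrable_cst].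
  by rewrite integral_cst//= probability_setT mule1.
apply: ge0_le_integral => //=.
- move=> x _; rewrite lee_fin; apply: sumr_ge0 => j _.
  by rewrite mulr_ge0// invr_ge0 ltW.
- exact/measurable_EFinP.
- exact/measurable_EFinP/measurable_funD.
- by move=> x _; rewrite lee_fin; have /andP[] := s_bounds x.
Qed.

End layer_cake.

(** * Averages of measures and injectivity on differences *)

Section mixture.
Local Open Scope ereal_scope.
Context d (T : measurableType d) (R : realType) (P Q : probability T R).

(** The factor one half makes the sum a probability again, so that a characteristic kernel can be
    applied to it. *)
Definition mixture : set T -> \bar R :=
  mscale (2^-1)%:nng%R (measure_add P Q).

HB.instance Definition _ := Measure.on mixture.

Lemma mixtureE A : mixture A = (2^-1)%:E * (P A + Q A).
Proof. by rewrite /mixture /mscale -(measure_addE P Q A). Qed.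

Let mixture_setT : mixture setT = 1.
Proof.
rewrite mixtureE !probability_setT -EFinD -EFinM; congr EFin.
by rewrite mulVf.
Qed.

HB.instance Definition _ := Measure_isProbability.Build _ _ _ mixture mixture_setT.

Lemma Rintegral_mixture (f : T -> R) :
  measurable_fun setT f -> (forall x, 0 <= f x <= 1)%R ->
  (\int[mixture]_x f x = 2^-1 * (\int[P]_x f x + \int[Q]_x f x))%R.
Proof.
move=> mf f01.
have f0 x : setT x -> 0 <= (f x)%:E by rewrite lee_fin; have /andP[] := f01 x.
have mf' : measurable_fun setT (EFin \o f) by exact/measurable_EFinP.
have fin P' := integrable_fin_num measurableT (integrable_bounded01 P' mf f01).
rewrite /Rintegral ge0_integral_mscale// ge0_integral_measure_add//.
rewrite fineM//; last by rewrite fin_numD !fin.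
by rewrite fineD; [|exact: fin|exact: fin].
Qed.

End mixture.

Section mean_embedding.
Context (R : realType) (T : ptopologicalType) (k : T -> T -> R).
Hypothesis k01 : forall x y, 0 <= k x y <= 1.
Hypothesis mk : forall y, measurable_fun (setT : set (Borel T)) (k^~ y).

(* Injectivity on probabilities passes to differences because
   [P2 - P1 = Q2 - Q1] means that two mixtures coincide. *)
Lemma characteristic_sub (P1 P2 Q1 Q2 : probability (Borel T) R) :
  characteristic k ->
  (forall y, mean_embedding k P2 y - mean_embedding k P1 y =
             mean_embedding k Q2 y - mean_embedding k Q1 y) ->
  forall A : set (Borel T), measurable A -> (P1 A < P2 A)%E -> (Q1 A < Q2 A)%E.
Proof.
move=> [_ inj] eqm A mA lt12.
have /inj - /(_ I I A mA) : mean_embedding k (mixture P2 Q1) =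
    mean_embedding k (mixture Q2 P1).
  apply/funext => y; rewrite /mean_embedding !Rintegral_mixture//.
  by have := eqm y; rewrite /mean_embedding; lra.
rewrite /= !mixtureE.
move: lt12.
rewrite -(fineK (fin_num_measure P1 A mA)) -(fineK (fin_num_measure P2 A mA)).
rewrite -(fineK (fin_num_measure Q1 A mA)) -(fineK (fin_num_measure Q2 A mA)).
by rewrite -!EFinD -!EFinM !lte_fin => lt12 [] ?; lra.
Qed.

End mean_embedding.

(** In the third case the intermediate value theorem gives [r] with [psi r = c], and strict decrease
    turns comparison of values into comparison of arguments. *)
Lemma superlevel_radius (R : realType) (psi : R -> R) (c : R) :
  {within `[0, +oo[, continuous psi} ->
  (forall s t, 0 <= s -> s < t -> psi t < psi s) ->
  [\/ forall t, 0 <= t -> psi t <= c,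
      forall t, 0 <= t -> c < psi t |
      exists2 r, 0 < r & forall t, 0 <= t -> (c < psi t) = (t < r)].
Proof.
move=> cpsi dpsi.
have dpsi_le s t : 0 <= s -> s <= t -> psi t <= psi s.
  by move=> s0; rewrite le_eqVlt => /predU1P[->//|st]; rewrite ltW// dpsi.
have [psi0|psi0] := leP (psi 0) c.
  by constructor 1 => t t0; rewrite (le_trans _ psi0)// dpsi_le.
have [[t0 [t00 psit0]]|/forallNP no_t] := pselect (exists t, 0 <= t /\ psi t <= c);
    last first.
  by constructor 2 => t t0; rewrite ltNge; apply/negP => ?; exact: (no_t t).
constructor 3.
have [|||r] := @IVT R psi 0 t0 c => //.
- by apply: continuous_subspaceW cpsi => x /=; rewrite !in_itv/= => /andP[-> _].
- by rewrite ge_min le_max psit0 (ltW psi0) orbT.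
rewrite in_itv/= => /andP[r0 rt0] psir; exists r.
  by rewrite lt_neqAle r0 andbT; apply: contraTneq psi0 => ->; rewrite psir ltxx.
move=> t tge0; rewrite -psir; apply/idP/idP => [|tr]; last exact: dpsi.
by apply: contraTT; rewrite -!leNgt; exact: dpsi_le.
Qed.

(** * Superlevel sets of a radial kernel and their radii *)

Section radial.
Context (R : realType) (H : normedModType R) (psi : R -> R).
Hypothesis psi_cont : {within `[0, +oo[, continuous psi}.
Hypothesis psi_decr : forall s t, 0 <= s -> s < t -> psi t < psi s.
Local Notation k := (radial_kernel H psi).

(** The centre [y] is quantified inside each alternative, so that one radius serves all centres. *)
Lemma superlevel_radial_kernel (c : R) :
  [\/ forall y : H, [set x | c < k x y] = set0,
      forall y : H, [set x | c < k x y] = setT |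
      exists2 r, 0 < r & forall y : H, [set x | c < k x y] = ball y r].
Proof.
have [psic|psic|[r r0 psic]] := superlevel_radius c psi_cont psi_decr.
- constructor 1 => y; apply/seteqP; split => x //=.
  by rewrite ltNge psic.
- constructor 2 => y; apply/seteqP; split => x //= _.
  exact: psic.
- constructor 3; exists r => // y; apply/seteqP; split => x /=;
    by rewrite -ball_normE/= psic// distrC.
Qed.

Lemma measurable_radial_kernel (y : H) :
  measurable_fun (setT : set (Borel H)) (k^~ y).
Proof.
apply: (measurability _ (RGenOInfty.measurableE R)) => _ [_ [c ->] <-].
rewrite setTI (_ : _ @^-1` _ = [set x | c < k x y]); last first.
  by apply/seteqP; split => x /=; rewrite in_itv/= andbT.
apply: sub_sigma_algebra.
have [->|->|[r r0 ->]] := superlevel_radial_kernel c.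
- exact: open0.
- exact: openT.
- exact: ball_open.
Qed.

(** Only [H], [psi] and [c] enter the choice; 1 is the default when no radius fits all centres. *)
Definition level_radius (c : R) : R :=
  xget 1 [set r | 0 < r /\ forall y : H, [set x | c < k x y] = ball y r].

(** For [delta > 0], one more than the integer part of [delta^-1] gives [N^-1 < delta]. *)
Definition level_radii (delta : R) : seq R :=
  let N := (Num.truncn delta^-1).+1 in
  [seq level_radius (j%:R / N%:R) | j <- iota 0 N].

Lemma exists_level_radius (P1 P2 : probability (Borel H) R) (y : H) :
  (forall x y : H, 0 <= k x y <= 1) ->
  mean_embedding k P1 y < mean_embedding k P2 y ->
  exists r, [/\ 0 < r,
    r \in level_radii (mean_embedding k P2 y - mean_embedding k P1 y) &
    (P1 (ball y r) < P2 (ball y r))%E].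
Proof.
set m1 := mean_embedding k P1 y; set m2 := mean_embedding k P2 y.
move=> k01 m12; set N := (Num.truncn (m2 - m1)^-1).+1.
have delta0 : 0 < m2 - m1 by rewrite subr_gt0.
have N_delta : N%:R^-1 < m2 - m1.
  rewrite invf_plt ?posrE ?ltr0n//.
  by rewrite truncnS_gt.
apply: contrapT => /forallNP no_r.
have : m2 <= m1 + N%:R^-1; last by lra.
apply: Rintegral_le_superlevel => //; first exact: measurable_radial_kernel.
move=> j jN; set c := j%:R / N%:R.
have [->|->|[r r0 rball]] := superlevel_radial_kernel c.
- by rewrite !measure0.
- by rewrite !probability_setT.
(* The radius [r] only shows that the choice in [level_radius c] succeeds; the chosen radius
   replaces it. *)
have [lr0 lrball] : 0 < level_radius c /\
    forall y : H, [set x | c < k x y] = ball y (level_radius c).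
  by apply: (@xgetPex _ 1 [set r | 0 < r /\ _]); exists r.
rewrite lrball leNgt; apply/negP => lt12; apply: (no_r (level_radius c)).
split => //; apply/mapP; exists j => //.
by rewrite mem_iota.
Qed.

End radial.

(** [radii] and [rho] are fixed before the measures: the number [m2 y - m1 y] confines [r] to a
    finite list, and the difference function selects from it. *)
Theorem theorem1 (R : realType) (H : completeNormedModType R)
    (dotH : {dot H for idfun}) (H_hilbert : inner_product_of_norm dotH)
    (H_separable : separable_space H)
    (psi : R -> R)
    (psi_range : forall t, 0 <= t -> 0 <= psi t <= 1)
    (psi_cont : {within `[0, +oo[, continuous psi})
    (psi_decr : forall s t, 0 <= s -> s < t -> psi t < psi s)
    (psi_pd : positive_definite_kernel (radial_kernel H psi))
    (k_transl : translation_invariant (radial_kernel H psi))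
    (k_char : characteristic (radial_kernel H psi)) :
  exists (radii : R -> seq R) (rho : (H -> R) -> H -> R),
    forall (P1 P2 : probability (Borel H) R) (y : H),
      let m1 := mean_embedding (radial_kernel H psi) P1 in
      let m2 := mean_embedding (radial_kernel H psi) P2 in
      m1 y < m2 y ->
      let r := rho (fun z => m2 z - m1 z) y in
      [/\ 0 < r, r \in radii (m2 y - m1 y) &
          (P1 (ball y r) < P2 (ball y r))%E].
Proof.
pose k := radial_kernel H psi.
have k01 x y : 0 <= k x y <= 1 by apply: psi_range.
have mk := @measurable_radial_kernel R H psi psi_cont psi_decr.
(* Any pair of probabilities whose embeddings differ by [D] may witness [r], so the choice of [r]
   depends on [D] and [y] but not on the given pair. *)
pose witness (D : H -> R) (y : H) (r : R) (P : probability (Borel H) R * probability (Borel H) R) :=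
  [/\ forall z, D z = mean_embedding k P.2 z - mean_embedding k P.1 z,
      0 < r, r \in level_radii H psi (D y) &
      (P.1 (ball y r) < P.2 (ball y r))%E].
exists (level_radii H psi), (fun D y => xget 1 [set r | exists P, witness D y r P]).
move=> P1 P2 y m1 m2 m12 r.
have [[Q1 Q2] [/= eqm r0 r_radii Qr]] :
    exists P, witness (fun z => m2 z - m1 z) y r P.
  apply: (@xgetPex _ 1 [set r | exists P, witness _ y r P]).
  have [r' [r'0 r'_radii r'P]] := exists_level_radius psi_cont psi_decr k01 m12.
  by exists r', (P1, P2).
split => //.
(* The gain for the witnessing pair carries over to [P1], [P2], whose embeddings have the same
   difference. *)
apply: (characteristic_sub k01 mk k_char _ _ Qr).
  by move=> z; rewrite -eqm.
by apply: sub_sigma_algebra; exact: ball_open.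
Qed.
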